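(* Let $L=L(\kappa,\kappa_s,\kappa_{ss},\dots)$ be a smooth function of finitely many arguments, and consider the one-dimensional $SE(2)$-invariant variational problem $\int L(\kappa,\kappa_s,\kappa_{ss},\dots)\,\mathrm{d}s$ for plane curves $(x(s),y(s))$ parametrized by Euclidean arc length $s$. Put $$\lambda(s)=-L+\sum_{m\ge 1}\sum_{j=0}^{m-1}(-1)^j\mathcal{D}_s^j\left(\frac{\partial L}{\partial\kappa_m}\right)\kappa_{m-j},$$ and let $c_1,c_2,c_3$ be the constants of Noether's conservation laws $$\begin{pmatrix}x_s&-y_s&0\\ y_s&x_s&0\\ xy_s-yx_s&xx_s+yy_s&1\end{pmatrix}\begin{pmatrix}-\lambda(s)-\kappa\mathsf{E}^\kappa(L)\\-\mathcal{D}_s\mathsf{E}^\kappa(L)\\ \mathsf{E}^\kappa(L)\end{pmatrix}=\begin{pmatrix}c_1\\c_2\\c_3\end{pmatrix}$$ along an extremal curve. Then a first integral of the invariantized Euler--Lagrange equation is $$\left(\lambda(s)+\kappa\mathsf{E}^\kappa(L)\right)^2+\left(\mathcal{D}_s\mathsf{E}^\kappa(L)\right)^2=c_1^2+c_2^2.$$ Moreover, once $\kappa$ is known, the extremal curve is given by $$x(s)=\frac{1}{c_1^2+c_2^2}\left(c_1\int\left[-\lambda(s)-\kappa\mathsf{E}^\kappa(L)\right]\mathrm{d}s-c_2\mathsf{E}^\kappa(L)+c_2c_3\right),$$ $$y(s)=\frac{1}{c_1^2+c_2^2}\left(c_2\int\left[-\lambda(s)-\kappa\mathsf{E}^\ka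ppa(L)\right]\mathrm{d}s+c_1\mathsf{E}^\kappa(L)+\frac{c_2^2c_3}{c_1}\right).$$
   Context: Curves are plane curves $(x(s),y(s))$ with $x_s^2+y_s^2=1$; subscripts $s$ denote derivatives in $s$, and $\mathcal{D}_s=\mathrm{d}/\mathrm{d}s$. The group $SE(2)$ acts on the plane by rotations and translations. The Euclidean curvature is $\kappa=x_sy_{ss}-y_sx_{ss}$, and $\kappa_m=\partial^m\kappa/\partial s^m$ (with $\kappa_0=\kappa$). The Euler operator is $\mathsf{E}^\kappa(L)=\sum_{m\ge 0}(-1)^m\mathcal{D}_s^m\left(\partial L/\partial\kappa_m\right)$. All expressions in $L$ are evaluated along the curve. An extremal curve is a curve that extremizes the functional $\int L\,\mathrm{d}s$; it satisfies the invariantized Euler--Lagrange equation $$\mathcal{D}_s^2\mathsf{E}^\kappa(L)+\kappa^2\mathsf{E}^\kappa(L)-\kappa\left(L-\sum_{m\ge1}\sum_{j=0}^{m-1}(-1)^j\mathcal{D}_s^j\left(\frac{\partial L}{\partial\kappa_m}\right)\kappa_{m-j}\right)=0.$$ Along an extremal, the left-hand side of the displayed matrix identity is constant in $s$ (Noether's conservation laws for the $SE(2)$-invariance), which defines $c_1,c_2,c_3$. The formulas for $x(s)$ and $y(s)$ are obtained by solving for $x,y$ the two linear equations $xc_1+yc_2=\int[-\lambda(s)-\kappa\mathsf{E}^\kappa(L)]\,\mathrm{d}s$ and $\mathsf{E}^\kappa(L)=yc_1-xc_2+c_3$, which follow from the conservation laws.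
   Formalization: The printed term c_2^2c_3/c_1 in y(s) is wrong (L=1, x=s, y=1 fails); it is replaced by -c_1c_3, for c_1^2+c_2^2≠0. The printed formulas are kept for y shifted by c_3/c_1, and, with independent integration constants in x and y, if c_1≠0 and (c_2≠0 or c_3=0). *)

(* Defs.v *)
From HB Require Import structures.
From mathcomp Require Import all_boot all_order all_algebra.
From mathcomp Require Import all_classical all_reals all_analysis.

Set Implicit Arguments.
Unset Strict Implicit.
Unset Printing Implicit Defensive.

Import Order.TTheory GRing.Theory Num.Theory.
Import numFieldNormedType.Exports.

Local Open Scope classical_set_scope.
Local Open Scope ring_scope.

(* C^k on A; meant for open A, where every derivative at a point of A depends
   only on f near that point. In finite dimension, quantifying over all
   directional derivatives amounts to iterating the Frechet derivative. *)
Fixpoint Ck_on (R : realType) (V W : normedModType R) (A : set V) (k : nat)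
    (f : V -> W) : Prop :=
  if k is k'.+1 then
    (forall p, A p -> differentiable f p) /\
    (forall v : V, Ck_on A k' ('D_v f))
  else forall p, A p -> {for p, continuous f}.

Definition smooth_on (R : realType) (V W : normedModType R) (A : set V)
    (f : V -> W) : Prop := forall k, Ck_on A k f.

(* [derive1] and [derive1n] are spelled out below: in ring_scope their usual
   notations denote derivatives of polynomials. *)
Definition antiderivative_on (R : realType) (I : set R) (f F : R -> R) : Prop :=
  forall s, I s -> derivable F s 1 /\ derive1 F s = f s.

Definition curvature (R : realType) (x y : R -> R) (s : R) : R :=
  derive1 x s * derive1n 2 y s - derive1 y s * derive1n 2 x s.

Section Lagrangian.
Variables (R : realType) (N : nat).
(* L(kappa_0, ..., kappa_N): the m-th coordinate is the slot of kappa_m. *)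
Variables (L : 'rV[R]_N.+1 -> R) (kappa : R -> R).

Definition jet (s : R) : 'rV[R]_N.+1 := \row_(m < N.+1) derive1n m kappa s.

Definition lagr (s : R) : R := L (jet s).

(* (dL / dkappa_m) evaluated along the curve *)
Definition dlagr (m : 'I_N.+1) (s : R) : R :=
  'D_(delta_mx 0 m : 'rV[R]_N.+1) L (jet s).

Definition euler_op (s : R) : R :=
  \sum_(m < N.+1) (-1) ^+ m * derive1n m (dlagr m) s.

Definition boundary_sum (s : R) : R :=
  \sum_(m < N.+1 | (1 <= m)%N) \sum_(0 <= j < m)
     (-1) ^+ j * derive1n j (dlagr m) s * derive1n (m - j) kappa s.

Definition lambda_ (s : R) : R := - lagr s + boundary_sum s.

Definition euler_lagrange_on (I : set R) : Prop :=
  forall s, I s ->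
    derive1n 2 euler_op s + kappa s ^+ 2 * euler_op s
      - kappa s * (lagr s - boundary_sum s) = 0.

End Lagrangian.

Definition noether_matrix (R : realType) (x y : R -> R) (s : R) : 'M[R]_3 :=
  \matrix_(i < 3, j < 3)
    nth 0 (nth [::]
      [:: [:: derive1 x s; - derive1 y s; 0];
          [:: derive1 y s; derive1 x s; 0];
          [:: x s * derive1 y s - y s * derive1 x s;
           x s * derive1 x s + y s * derive1 y s; 1]]
      i) j.

Definition col3 (R : realType) (a b c : R) : 'cV[R]_3 :=
  \col_(i < 3) nth 0 [:: a; b; c] i.

Definition conservation_laws_on (R : realType) (N : nat)
    (L : 'rV[R]_N.+1 -> R) (I : set R) (x y : R -> R) (c1 c2 c3 : R) : Prop :=
  let kappa := curvature x y in
  let E := euler_op L kappa in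
  forall s, I s ->
    noether_matrix x y s
      *m col3 (- lambda_ L kappa s - kappa s * E s) (- derive1 E s) (E s)
    = col3 c1 c2 c3.

(* Extremal in the sense of the calculus of variations: a critical curve, i.e.
   one satisfying the invariantized Euler-Lagrange equation. Every curve that
   extremizes the functional is of this kind. *)
Definition extremal_curve_on (R : realType) (N : nat)
    (L : 'rV[R]_N.+1 -> R) (I : set R) (x y : R -> R) : Prop :=
  [/\ smooth_on I x, smooth_on I y,
      (forall s, I s -> derive1 x s ^+ 2 + derive1 y s ^+ 2 = 1)
    & euler_lagrange_on L (curvature x y) I].

(* Main.v *)
Require Import Defs.
From HB Require Import structures.
From mathcomp Require Import all_boot all_order all_algebra.
From mathcomp Require Import all_classical all_reals all_analysis.
From mathcomp Require Import ring lra.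

(* Telescoping the boundary sum gives d lambda/ds = - kappa_s E. Put
   a = - lambda - kappa E and b = - E_s. Together with the Euler-Lagrange
   equation this says a_s = kappa b and b_s = - kappa a, while the Frenet
   equations are x_ss = - kappa y_s and y_ss = kappa x_s: the vector (a, b)
   rotates against the frame, so the left-hand sides of the conservation laws
   have zero derivative, and a^2 + b^2 = c1^2 + c2^2 by the unit speed.
   No integration theory is needed: the conservation laws give
   (c1 x + c2 y)_s = a, so c1 x + c2 y is an antiderivative of a. *)

Set Implicit Arguments.
Unset Strict Implicit.
Unset Printing Implicit Defensive.

Import Order.TTheory GRing.Theory Num.Theory.
Import numFieldNormedType.Exports.

Local Open Scope classical_set_scope.
Local Open Scope ring_scope.

(** * Finite-order differentiability of real functions on an open set *)

Section Diffk.
Variables (R : realType) (I : set R).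
Hypothesis oI : open I.

(** Order [0] asks nothing, not even continuity, so closure proofs by induction on [k] have a
    trivial base case. *)
Fixpoint diffk_on (k : nat) (f : R -> R) : Prop :=
  if k is k'.+1 then
    (forall s, I s -> derivable f s 1) /\ diffk_on k' (derive1 f)
  else True.

Lemma is_derive_eq_on (f g : R -> R) (s d : R) :
  I s -> (forall t, I t -> f t = g t) -> is_derive s 1 f d -> is_derive s 1 g d.
Proof.
move=> Is fg; apply: near_eq_is_derive.
by near=> t; apply: fg; near: t; exact: open_nbhs_nbhs.
Unshelve. all: by end_near. Qed.

Lemma is_derive_derive1 (f : R -> R) (s : R) : derivable f s 1 ->
  is_derive s 1 f (derive1 f s).
Proof. by move=> /derivableP; rewrite derive1E. Qed.

Lemma derive1_val (f : R -> R) (s d : R) : is_derive s 1 f d -> derive1 f s = d.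
Proof. by move=> fd; rewrite derive1E derive_val. Qed.

Lemma diffk_on_eq k (f g : R -> R) :
  (forall t, I t -> f t = g t) -> diffk_on k f -> diffk_on k g.
Proof.
elim: k f g => //= k IH f g fg [df dk].
have fgd s : I s -> is_derive s 1 g (derive1 f s).
  by move=> Is; apply: is_derive_eq_on fg _ => //; exact/is_derive_derive1/df.
split=> [s Is|]; first by case: (fgd s Is).
by apply: IH dk => s Is; rewrite (derive1_val (fgd s Is)).
Qed.

(** The induction step of the closure lemmas: a formula for the derivative need only agree with
    [derive1 f] on [I], because [I] is open. *)
Lemma diffk_on_is_derive k (f df : R -> R) :
  (forall s, I s -> is_derive s 1 f (df s)) -> diffk_on k df ->
  diffk_on k.+1 f.
Proof.
move=> fdf dk; split=> [s Is|]; first by case: (fdf s Is).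
by apply: diffk_on_eq dk => s Is; rewrite (derive1_val (fdf s Is)).
Qed.

Lemma diffk_onW k f : diffk_on k.+1 f -> diffk_on k f.
Proof. by elim: k f => // k IH f [df dk]; split=> //; exact: IH. Qed.

Lemma diffk_on_cst k c : diffk_on k (fun=> c).
Proof.
by elim: k c => // k IH c; apply: (@diffk_on_is_derive _ _ (fun=> 0)).
Qed.

Lemma is_derive1D (f g : R -> R) (s df dg : R) :
  is_derive s 1 f df -> is_derive s 1 g dg ->
  is_derive s 1 (fun t => f t + g t) (df + dg).
Proof. exact: is_deriveD. Qed.

Lemma is_derive1N (f : R -> R) (s df : R) :
  is_derive s 1 f df -> is_derive s 1 (fun t => - f t) (- df).
Proof. exact: is_deriveN. Qed.

Lemma is_derive1B (f g : R -> R) (s df dg : R) :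
  is_derive s 1 f df -> is_derive s 1 g dg ->
  is_derive s 1 (fun t => f t - g t) (df - dg).
Proof. exact: is_deriveB. Qed.

Lemma is_derive1M (f g : R -> R) (s df dg : R) :
  is_derive s 1 f df -> is_derive s 1 g dg ->
  is_derive s 1 (fun t => f t * g t) (f s * dg + df * g s).
Proof. by move=> ff gg; rewrite [df * _]mulrC; exact: is_deriveM. Qed.

Lemma is_derive1_sum (T : Type) (r : seq T) (P : pred T) (F : T -> R -> R) (dF : T -> R) (s : R) :
  (forall i, P i -> is_derive s 1 (F i) (dF i)) ->
  is_derive s 1 (fun t => \sum_(i <- r | P i) F i t) (\sum_(i <- r | P i) dF i).
Proof.
move=> FdF; elim: r => [|i r IH].
  rewrite big_nil; under eq_fun do rewrite big_nil.
  exact: is_derive_cst.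
rewrite big_cons; under eq_fun do rewrite big_cons.
by case: ifP => // Pi; apply: is_derive1D => //; exact: FdF.
Qed.

Lemma diffk_onD k f g :
  diffk_on k f -> diffk_on k g -> diffk_on k (fun s => f s + g s).
Proof.
elim: k f g => // k IH f g [df fk] [dg gk].
apply: diffk_on_is_derive (IH _ _ fk gk) => s Is.
by apply: is_derive1D; apply: is_derive_derive1; [exact: df|exact: dg].
Qed.

Lemma diffk_onM k f g :
  diffk_on k f -> diffk_on k g -> diffk_on k (fun s => f s * g s).
Proof.
elim: k f g => // k IH f g fk gk; have [df fk'] := fk; have [dg gk'] := gk.
apply: (diffk_on_is_derive (df := fun s => f s * derive1 g s + derive1 f s * g s)).
  move=> s Is.
  by apply: is_derive1M; apply: is_derive_derive1; [exact: df|exact: dg].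
by apply: diffk_onD; apply: IH => //; exact: diffk_onW.
Qed.

Lemma diffk_on_sum k (T : Type) (r : seq T) (P : pred T) (F : T -> R -> R) :
  (forall i, P i -> diffk_on k (F i)) ->
  diffk_on k (fun s => \sum_(i <- r | P i) F i s).
Proof.
move=> Fk; elim: r => [|i r IH].
  under eq_fun do rewrite big_nil.
  exact: diffk_on_cst.
under eq_fun do rewrite big_cons.
by case Pi : (P i) => //; apply: diffk_onD => //; exact: Fk.
Qed.

(** * Chain rule along a curve of row vectors *)

Lemma is_derive_comp_row n (g : 'rV[R]_n.+1 -> R) (c : R -> 'rV[R]_n.+1)
    (dc : 'I_n.+1 -> R) (s : R) :
  differentiable g (c s) ->
  (forall m, is_derive s 1 (fun t => c t 0 m) (dc m)) ->
  is_derive s 1 (fun t => g (c t))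
    (\sum_(m < n.+1) 'D_(delta_mx 0 m : 'rV[R]_n.+1) g (c s) * dc m).
Proof.
move=> dg dcm.
have cs : derivable c s 1.
  by apply/derivable_mxP => i j; rewrite ord1; exact: ex_derive.
have dcs : differentiable c s by exact/derivable1_diffP.
apply: DeriveDef; first exact/derivable1_diffP/differentiable_comp.
rewrite deriveE; last exact: differentiable_comp.
(* The velocity of [c] is expanded in the standard basis, and linearity of the differential of [g]
   turns it into partial derivatives. *)
rewrite diff_comp//= -(deriveE (1 : R) dcs) [X in 'd g _ X]row_sum_delta linear_sum.
apply: eq_bigr => m _; rewrite linearZ/= -deriveE// mulrC derive_mx// mxE.
by rewrite derive_val.
Qed.

Lemma smooth_on_derive (V W : normedModType R) (A : set V) (f : V -> W) v :
  smooth_on A f -> smooth_on A ('D_v f).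
Proof. by move=> sf k; have [_] := sf k.+1; exact. Qed.

Lemma smooth_on_diff (V W : normedModType R) (A : set V) (f : V -> W) p :
  smooth_on A f -> A p -> differentiable f p.
Proof. by move=> sf; have [df _] := sf 1%N; exact: df. Qed.

(** The chain rule yields products of partial derivatives of [g] along [c] with coordinate
    derivatives; those partials are smooth again, so the induction runs over all [g]. *)
Lemma diffk_on_comp_row k n (g : 'rV[R]_n.+1 -> R) (c : R -> 'rV[R]_n.+1) :
  smooth_on setT g -> (forall m, diffk_on k (fun t => c t 0 m)) ->
  diffk_on k (fun t => g (c t)).
Proof.
elim: k g => // k IH g sg ck.
apply: (diffk_on_is_derive (df := fun s => \sum_(m < n.+1)
   'D_(delta_mx 0 m : 'rV[R]_n.+1) g (c s) * derive1 (fun t => c t 0 m) s)).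
  move=> s Is; apply: is_derive_comp_row; first exact: (smooth_on_diff sg).
  by move=> m; apply: is_derive_derive1; have [+ _] := ck m; exact.
apply: diffk_on_sum => m _; apply: diffk_onM; last by have [] := ck m.
apply: (IH ('D_(delta_mx 0 m : 'rV[R]_n.+1) g)) => [|i].
  exact: smooth_on_derive.
by apply: diffk_onW; exact: ck.
Qed.

(** * Smooth functions of one variable *)

Definition smooth1 (f : R -> R) : Prop := forall k, diffk_on k f.

Lemma smooth1P (f : R -> R) :
  smooth1 f <-> (forall s, I s -> derivable f s 1) /\ smooth1 (derive1 f).
Proof.
split=> [sf|[df sf] [|k] //].
by split=> [|k]; [have [] := sf 1%N|have [] := sf k.+1].
Qed.

Lemma smooth1_derive1n f n : smooth1 f -> smooth1 (derive1n n f).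
Proof. by move=> sf; elim: n => // n /smooth1P[]; rewrite derive1nS. Qed.

Lemma smooth1_is_derive f (s : R) :
  smooth1 f -> I s -> is_derive s 1 f (derive1 f s).
Proof. by move=> /smooth1P[df _] Is; exact/is_derive_derive1/df. Qed.

Lemma smooth_on_smooth1 (f : R -> R) : smooth_on I f -> smooth1 f.
Proof.
move=> sf k; elim: k f sf => // k IH f sf; split=> [s Is|].
  by apply/derivable1_diffP; exact: (smooth_on_diff sf Is).
have -> : derive1 f = 'D_1 f by apply/funext => s; rewrite derive1E.
exact/IH/smooth_on_derive.
Qed.

Lemma smooth1_sum (T : Type) (r : seq T) (P : pred T) (F : T -> R -> R) :
  (forall i, P i -> smooth1 (F i)) ->
  smooth1 (fun s => \sum_(i <- r | P i) F i s).
Proof. by move=> sF k; apply: diffk_on_sum => i Pi; exact: sF. Qed.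

Hypothesis itvI : is_interval I.

(** Mean value theorem on the segment between the two points, which lies in [I] because [I] is an
    interval. *)
Lemma is_derive0_cst (f : R -> R) :
  (forall s, I s -> is_derive s 1 f 0) -> forall a b, I a -> I b -> f a = f b.
Proof.
move=> f0; suff H a b : I a -> I b -> a < b -> f a = f b.
  move=> a b Ia Ib; have [ab|ba|->//] := ltgtP a b; first exact: H.
  by apply/esym/H.
move=> Ia Ib ab.
have inI z : a <= z <= b -> I z by exact: itvI.
have fab z : z \in `]a, b[%R -> is_derive z 1 f 0.
  by rewrite in_itv/= => /andP[az zb]; apply/f0/inI; rewrite !ltW.
have cf : {within `[a, b], continuous f}.
  by apply: derivable_within_continuous => z; rewrite in_itv/= => /inI/f0[].
have [c _] := MVT ab fab cf.
by rewrite mul0r => /eqP; rewrite subr_eq0 => /eqP.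
Qed.

End Diffk.

Section Noether.
Variables (R : realType) (I : set R).
Hypothesis oI : open I.

(** * Derivatives of the Lagrangian, the boundary sum and lambda along the curve *)

Section Boundary.
Variables (N : nat) (L : 'rV[R]_N.+1 -> R) (kappa : R -> R).
Hypotheses (sL : smooth_on setT L) (sk : smooth1 I kappa).

Lemma jetE m : (fun t => jet N kappa t 0 m) = derive1n m kappa.
Proof. by apply/funext => t; rewrite mxE. Qed.

Lemma smooth1_dlagr m : smooth1 I (dlagr L kappa m).
Proof.
move=> k; apply: (diffk_on_comp_row oI
    (g := 'D_(delta_mx 0 m : 'rV[R]_N.+1) L) (c := jet N kappa)) => [|i].
  exact: smooth_on_derive.
by rewrite jetE; exact: smooth1_derive1n.
Qed.

Lemma smooth1_euler_op : smooth1 I (euler_op L kappa).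
Proof.
apply: smooth1_sum => // m _ k.
apply: diffk_onM => //; first exact: diffk_on_cst.
exact/smooth1_derive1n/smooth1_dlagr.
Qed.

Lemma is_derive_lagr s : I s ->
  is_derive s 1 (lagr L kappa)
    (\sum_(m < N.+1) dlagr L kappa m s * derive1n m.+1 kappa s).
Proof.
move=> Is; apply: (is_derive_comp_row (g := L) (c := jet N kappa)
    (dc := fun m => derive1n m.+1 kappa s)).
  exact: (smooth_on_diff sL).
by move=> m; rewrite jetE; apply: smooth1_is_derive Is; exact: smooth1_derive1n.
Qed.

Lemma is_derive_boundary_sum s : I s ->
  is_derive s 1 (boundary_sum L kappa)
    (\sum_(m < N.+1) dlagr L kappa m s * derive1n m.+1 kappa s
     - derive1 kappa s * euler_op L kappa s).
Proof.
move=> Is.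
(* The j-th summand has derivative a m j - a m j.+1, so the sum over j
   telescopes to a m 0 - a m m: the m-th terms of dL/ds and of kappa_s E. *)
pose a (m : 'I_N.+1) j :=
  (-1) ^+ j * derive1n j (dlagr L kappa m) s * derive1n (m - j).+1 kappa s.
have da (m : 'I_N.+1) j : (j < m)%N -> is_derive s 1
    (fun t => (-1) ^+ j * derive1n j (dlagr L kappa m) t * derive1n (m - j) kappa t)
    (a m j - a m j.+1).
  move=> jm; apply: is_derive_eq.
    apply: is_derive1M.
      apply: is_derive1M.
      by apply: smooth1_is_derive Is; exact/smooth1_derive1n/smooth1_dlagr.
    by apply: smooth1_is_derive Is; exact: smooth1_derive1n.
  (* Since j < m, (m - j.+1).+1 equals m - j, so the second term of the product rule is
     [- a m j.+1]. *)
  by rewrite /a subnSK// exprS mul0r addr0 !mulN1r !mulNr opprK.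
apply: (@is_derive_eq _ _ _ _ _ _ _
    (\sum_(m < N.+1 | (1 <= m)%N) \sum_(0 <= j < m) (a m j - a m j.+1))).
  apply: is_derive1_sum => m _.
  under eq_fun do rewrite big_seq_cond.
  rewrite big_seq_cond; apply: is_derive1_sum => j.
  by rewrite mem_index_iota andbT => jm; exact: da.
have tele (m : 'I_N.+1) : \sum_(0 <= j < m) (a m j - a m j.+1) = a m 0%N - a m m.
  under eq_bigr do rewrite -opprB.
  by rewrite sumrN telescope_sumr// opprB.
(* The sum extends to m = 0, where [a m 0 - a m m] vanishes. *)
have -> : \sum_(m < N.+1 | (1 <= m)%N) \sum_(0 <= j < m) (a m j - a m j.+1)
    = \sum_(m < N.+1) (a m 0%N - a m m).
  rewrite big_mkcond; apply: eq_bigr => m _.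
  case: posnP => [m0|_]; last exact: tele.
  by rewrite -tele m0 big_geq.
rewrite sumrB /a mulr_sumr; congr (_ - _); apply: eq_bigr => m _.
  by rewrite expr0 mul1r subn0.
by rewrite subnn mulrC.
Qed.

Lemma is_derive_lambda s : I s ->
  is_derive s 1 (lambda_ L kappa) (- (derive1 kappa s * euler_op L kappa s)).
Proof.
move=> Is; apply: is_derive_eq.
  apply: is_derive1D; last exact: is_derive_boundary_sum.
  by apply: is_derive1N; exact: is_derive_lagr.
by rewrite addKr.
Qed.

End Boundary.

(** * Frenet equations for a unit-speed curve *)

Section Curve.
Variables (x y : R -> R).
Hypotheses (sx : smooth1 I x) (sy : smooth1 I y).
Hypothesis unit_speed : forall s, I s -> derive1 x s ^+ 2 + derive1 y s ^+ 2 = 1.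

Lemma smooth1_curvature : smooth1 I (curvature x y).
Proof.
have dM f g : smooth1 I f -> smooth1 I g ->
    smooth1 I (fun s => derive1 f s * derive1n 2 g s).
  by move=> sf sg k; apply: diffk_onM => //;
    [exact: (smooth1_derive1n 1)|exact: smooth1_derive1n].
move=> k; apply: diffk_onD; rewrite //; first exact: dM.
under eq_fun do rewrite -mulN1r.
by apply: diffk_onM; rewrite //; [exact: diffk_on_cst|exact: dM].
Qed.

(** Half the derivative of the unit-speed identity. *)
Lemma velocity_orthogonal s : I s ->
  derive1 x s * derive1n 2 x s + derive1 y s * derive1n 2 y s = 0.
Proof.
move=> Is.
have d f : smooth1 I f -> is_derive s 1 (derive1 f) (derive1n 2 f s).
  by move=> sf; apply: smooth1_is_derive Is; exact: (smooth1_derive1n 1).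
have := is_derive1D (is_derive1M (d _ sx) (d _ sx)) (is_derive1M (d _ sy) (d _ sy)).
move/(is_derive_eq_on oI (g := fun=> 1) Is).
have sq t : I t -> derive1 x t * derive1 x t + derive1 y t * derive1 y t = 1.
  by move/unit_speed; rewrite !expr2.
move/(_ sq)/derive1_val; rewrite derive1_cst.
move: (derive1 x s) (derive1 y s) (derive1n 2 x s) (derive1n 2 y s).
by move=> x1 y1 x2 y2; lra.
Qed.

Lemma is_derive_dx s : I s ->
  is_derive s 1 (derive1 x) (- (curvature x y s * derive1 y s)).
Proof.
move=> Is; have h := velocity_orthogonal Is; have u := unit_speed Is.
suff -> : - (curvature x y s * derive1 y s) = derive1n 2 x s.
  by apply: smooth1_is_derive Is; exact: (smooth1_derive1n 1).
apply/esym/eqP; rewrite -subr_eq0 /curvature; apply/eqP.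
move: (derive1n 2 x s) (derive1n 2 y s) (derive1 x s) (derive1 y s) h u.
move=> x2 y2 x1 y1 h u.
(* The difference is a combination of the unit-speed defect and the orthogonality relation, both
   zero. *)
have -> : x2 - - ((x1 * y2 - y1 * x2) * y1)
  = (1 - (x1 ^+ 2 + y1 ^+ 2)) * x2 + x1 * (x1 * x2 + y1 * y2) by ring.
by rewrite h u subrr mul0r mulr0 addr0.
Qed.

Lemma is_derive_dy s : I s ->
  is_derive s 1 (derive1 y) (curvature x y s * derive1 x s).
Proof.
move=> Is; have h := velocity_orthogonal Is; have u := unit_speed Is.
suff -> : curvature x y s * derive1 x s = derive1n 2 y s.
  by apply: smooth1_is_derive Is; exact: (smooth1_derive1n 1).
apply/esym/eqP; rewrite -subr_eq0 /curvature; apply/eqP.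
move: (derive1n 2 x s) (derive1n 2 y s) (derive1 x s) (derive1 y s) h u.
move=> x2 y2 x1 y1 h u.
have -> : y2 - (x1 * y2 - y1 * x2) * x1
  = (1 - (x1 ^+ 2 + y1 ^+ 2)) * y2 + y1 * (x1 * x2 + y1 * y2) by ring.
by rewrite h u subrr mul0r mulr0 addr0.
Qed.

(** * Conservation of the three Noether quantities *)

Section Moments.
Variables (a b E : R -> R).
Hypothesis da : forall s, I s -> is_derive s 1 a (curvature x y s * b s).
Hypothesis db : forall s, I s -> is_derive s 1 b (- (curvature x y s * a s)).
Hypothesis dE : forall s, I s -> is_derive s 1 E (- b s).

Lemma is_derive_moment1 s : I s ->
  is_derive s 1 (fun t => derive1 x t * a t - derive1 y t * b t) 0.
Proof.
move=> Is; apply: is_derive_eq (is_derive1B (is_derive1M (is_derive_dx Is) (da Is))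
  (is_derive1M (is_derive_dy Is) (db Is))) _.
by ring.
Qed.

Lemma is_derive_moment2 s : I s ->
  is_derive s 1 (fun t => derive1 y t * a t + derive1 x t * b t) 0.
Proof.
move=> Is; apply: is_derive_eq (is_derive1D (is_derive1M (is_derive_dy Is) (da Is))
  (is_derive1M (is_derive_dx Is) (db Is))) _.
by ring.
Qed.

Lemma is_derive_moment3 s : I s ->
  is_derive s 1 (fun t => (x t * derive1 y t - y t * derive1 x t) * a t
    + (x t * derive1 x t + y t * derive1 y t) * b t + E t) 0.
Proof.
move=> Is; have dx := smooth1_is_derive sx Is; have dy := smooth1_is_derive sy Is.
have dx2 := is_derive_dx Is; have dy2 := is_derive_dy Is.
have dl := is_derive1M (is_derive1B (is_derive1M dx dy2) (is_derive1M dy dx2)) (da Is).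
have dr := is_derive1M (is_derive1D (is_derive1M dx dx2) (is_derive1M dy dy2)) (db Is).
apply: is_derive_eq (is_derive1D (is_derive1D dl dr) (dE Is)) _.
(* Differentiating the moment arms leaves (x_s^2 + y_s^2) b, which E_s = - b cancels once written
   with the same factor. *)
have -> : - b s = - (derive1 x s ^+ 2 + derive1 y s ^+ 2) * b s.
  by rewrite unit_speed// mulN1r.
by ring.
Qed.

End Moments.

Lemma conservation_lawsP (N : nat) (L : 'rV[R]_N.+1 -> R) c1 c2 c3 :
  let kappa := curvature x y in
  let E := euler_op L kappa in
  let a := fun s => - lambda_ L kappa s - kappa s * E s in
  let b := fun s => - derive1 E s in
  conservation_laws_on L I x y c1 c2 c3 <->
  (forall s, I s ->
    [/\ derive1 x s * a s - derive1 y s * b s = c1,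
        derive1 y s * a s + derive1 x s * b s = c2
      & (x s * derive1 y s - y s * derive1 x s) * a s
        + (x s * derive1 x s + y s * derive1 y s) * b s + E s = c3]).
Proof.
move=> kappa E a b.
split=> [H s Is|H k e s Is].
  have /matrixP M := H s Is; split.
  - by have := M 0 0; rewrite !mxE !big_ord_recl big_ord0 !mxE/= mul0r !addr0 mulNr.
  - by have := M 1 0; rewrite !mxE !big_ord_recl big_ord0 !mxE/= mul0r !addr0.
  - by have := M (1 + 1) 0; rewrite !mxE !big_ord_recl big_ord0 !mxE/= mul1r !addr0 addrA.
have [h1 h2 h3] := H s Is; apply/matrixP => i j; rewrite {j}ord1.
rewrite !mxE !big_ord_recl big_ord0 !mxE/= addr0.
case: i => [[|[|[|//]]]] /= _.
- by rewrite mul0r addr0 mulNr.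
- by rewrite mul0r addr0.
- by rewrite mul1r addrA.
Qed.

End Curve.
End Noether.

(* An indefinite integral is an arbitrary antiderivative F plus a constant of
   integration. Solving x c1 + y c2 = P, E = y c1 - x c2 + c3 for y gives the
   constant term - c1 c3, whereas c2^2 c3 / c1 = - c1 c3 + (c1^2 + c2^2) c3 / c1.
   With the same P in x and y, the formula with c2^2 c3 / c1 hence describes the
   extremal translated by c3 / c1 along the y-axis; it describes the extremal
   itself when x and y may use different constants of integration, provided
   c2 <> 0 or c3 = 0. *)
Theorem mainTheorem2 (R : realType) (N : nat) (L : 'rV[R]_N.+1 -> R)
    (I : set R) (x y : R -> R) :
  smooth_on setT L ->
  open I -> is_interval I ->
  extremal_curve_on L I x y ->
  let kappa := curvature x y in
  let E := euler_op L kappa in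
  let lambda := lambda_ L kappa in
  let integrand := fun s => - lambda s - kappa s * E s in
  (exists c1 c2 c3, conservation_laws_on L I x y c1 c2 c3) /\
  (exists F, antiderivative_on I integrand F) /\
  forall c1 c2 c3, conservation_laws_on L I x y c1 c2 c3 ->
    (forall s, I s ->
       (lambda s + kappa s * E s) ^+ 2 + derive1 E s ^+ 2 = c1 ^+ 2 + c2 ^+ 2)
    /\
    (forall F, antiderivative_on I integrand F ->
       (c1 ^+ 2 + c2 ^+ 2 != 0 ->
          exists k, forall s, I s ->
            [/\ x s = (c1 ^+ 2 + c2 ^+ 2)^-1
                        * (c1 * (F s + k) - c2 * E s + c2 * c3),
                y s = (c1 ^+ 2 + c2 ^+ 2)^-1
                        * (c2 * (F s + k) + c1 * E s - c1 * c3)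
              & c1 != 0 ->
                y s + c3 / c1 = (c1 ^+ 2 + c2 ^+ 2)^-1
                        * (c2 * (F s + k) + c1 * E s + c2 ^+ 2 * c3 / c1)])
       /\
       (c1 != 0 -> c2 != 0 \/ c3 = 0 ->
          exists kx ky, forall s, I s ->
            x s = (c1 ^+ 2 + c2 ^+ 2)^-1
                    * (c1 * (F s + kx) - c2 * E s + c2 * c3) /\
            y s = (c1 ^+ 2 + c2 ^+ 2)^-1
                    * (c2 * (F s + ky) + c1 * E s + c2 ^+ 2 * c3 / c1))).
Proof.
move=> sL oI itvI [/smooth_on_smooth1 sx /smooth_on_smooth1 sy us EL].
move=> kappa E lambda integrand.
have sk : smooth1 I kappa := smooth1_curvature oI sx sy.
have sE : smooth1 I E := smooth1_euler_op oI sL sk.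
pose a := integrand; pose b s := - derive1 E s.
have dE s : I s -> is_derive s 1 E (- b s).
  by move=> Is; rewrite opprK; exact: smooth1_is_derive.
have da s : I s -> is_derive s 1 a (kappa s * b s).
  move=> Is; have dl := is_derive_lambda oI sL sk Is.
  have dkE := is_derive1M (smooth1_is_derive sk Is) (smooth1_is_derive sE Is).
  apply: is_derive_eq (is_derive1B (is_derive1N dl) dkE) _.
  rewrite opprK /b -/E.
  move: (derive1 kappa s) (kappa s) (E s) (derive1 E s) => k1 k e e1.
  by ring.
have db s : I s -> is_derive s 1 b (- (kappa s * a s)).
  move=> Is.
  have d2E : is_derive s 1 (derive1 E) (derive1n 2 E s).
    exact: smooth1_is_derive (smooth1_derive1n 1 sE) Is.
  apply: is_derive_eq (is_derive1N d2E) _.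
  have := EL s Is; rewrite -/kappa -/E /a /integrand /lambda /lambda_.
  move: (derive1n 2 E s) (E s) (kappa s) (lagr _ _ s) (boundary_sum _ _ s).
  move=> e2 e k l B h.
  (* The Euler-Lagrange expression is isolated so that [h] removes it. *)
  have -> : e2 = e2 + k ^+ 2 * e - k * (l - B) - (k ^+ 2 * e - k * (l - B)) by ring.
  by rewrite h; ring.
have claws c1 c2 c3 : conservation_laws_on L I x y c1 c2 c3 <->
    (forall s, I s ->
      [/\ derive1 x s * a s - derive1 y s * b s = c1,
          derive1 y s * a s + derive1 x s * b s = c2
        & (x s * derive1 y s - y s * derive1 x s) * a s
          + (x s * derive1 x s + y s * derive1 y s) * b s + E s = c3]).
  exact: conservation_lawsP.
(* The constants are values at a base point [s0], so empty [I] is treated apart. *)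
have [I0|/set0P[s0 Is0]] := eqVneq I set0.
  have In s : ~ I s by rewrite I0.
  split; first by exists 0, 0, 0 => k e s /In.
  split; first by exists (fun=> 0) => s /In.
  move=> c1 c2 c3 _; split=> [s /In//|F _].
  split; first by exists 0 => s /In.
  by exists 0, 0 => s /In.
have [c1 [c2 [c3 c123]]] : exists c1 c2 c3, conservation_laws_on L I x y c1 c2 c3.
  do 3 eexists; apply/claws => s Is; split.
  - exact: (is_derive0_cst itvI (is_derive_moment1 oI sx sy us da db) Is Is0).
  - exact: (is_derive0_cst itvI (is_derive_moment2 oI sx sy us da db) Is Is0).
  - exact: (is_derive0_cst itvI (is_derive_moment3 oI sx sy us da db dE) Is Is0).
have dP (d1 d2 d3 : R) : conservation_laws_on L I x y d1 d2 d3 ->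
    forall s, I s -> is_derive s 1 (fun t => d1 * x t + d2 * y t) (a s).
  move=> /claws d123 s Is; have [h1 h2 _] := d123 s Is.
  have dx := is_derive1M (is_derive_cst d1 s 1) (smooth1_is_derive sx Is).
  have dy := is_derive1M (is_derive_cst d2 s 1) (smooth1_is_derive sy Is).
  apply: is_derive_eq (is_derive1D dx dy) _; rewrite /cst.
  (* With c1 and c2 replaced by their expressions, the terms in b cancel and (x_s^2 + y_s^2) a
     remains. *)
  rewrite -[RHS]mul1r -(us s Is) -h1 -h2.
  move: (a s) (b s) (x s) (y s) (derive1 x s) (derive1 y s).
  by move=> a' b' x' y' x1 y1; ring.
split; first by exists c1, c2, c3.
split.
  exists (fun t => c1 * x t + c2 * y t) => s /(dP _ _ _ c123) h.
  by split; [case: h|exact: derive1_val].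
move=> {c123}d1 d2 d3 d123; have h123 := (claws _ _ _).1 d123.
split=> [s Is|F dF].
  have [<- <- _] := h123 s Is.
  (* Multiplicativity of the norm: c1 + i c2 is the product of x_s + i y_s and a + i b. *)
  transitivity ((derive1 x s ^+ 2 + derive1 y s ^+ 2) * (a s ^+ 2 + b s ^+ 2)).
    rewrite us// /a /b /integrand.
    by move: (lambda s) (kappa s * E s) (derive1 E s) => l ke e1; ring.
  move: (a s) (b s) (derive1 x s) (derive1 y s) => a' b' x1 y1.
  by ring.
have [k hk] : exists k, forall s, I s -> d1 * x s + d2 * y s = F s + k.
  exists (d1 * x s0 + d2 * y s0 - F s0) => s Is.
  apply/eqP; rewrite -subr_eq0 opprD addrA subr_eq0; apply/eqP.
  apply: (is_derive0_cst itvI (f := fun t => d1 * x t + d2 * y t - F t)) => // t It.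
  have [dFt Ft] := dF t It; have := is_derive_derive1 dFt; rewrite Ft => dFt'.
  by apply: is_derive_eq (is_derive1B (dP _ _ _ d123 t It) dFt') _; rewrite subrr.
(* The third law is x times the second minus y times the first, plus E. *)
have hE s : I s -> E s = d1 * y s - d2 * x s + d3.
  move=> Is; have [<- <- <-] := h123 s Is.
  by rewrite -/kappa -/E; ring.
split=> [n0|d10 d23].
  (* What remains is the solution of a linear system in x, y with determinant of modulus c1^2 +
     c2^2. *)
  exists k => s Is; rewrite -hk// hE//.
  split=> [||d10]; field; rewrite ?n0 ?d10 //.
have n0 : d1 ^+ 2 + d2 ^+ 2 != 0.
  by rewrite paddr_eq0 ?sqr_ge0// negb_and sqrf_eq0 d10.
have [d20|d20] := eqVneq d2 0.
  have d30 : d3 = 0 by case: d23 => //; rewrite d20 eqxx.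
  exists k, k => s Is; rewrite -hk// hE// d30; split; field; by rewrite ?n0 ?d10.
(* The second constant solves c2 (ky - k) = - c1 c3 - c2^2 c3 / c1, absorbing the discrepancy in the
   constant term of y. *)
exists k, (k - d3 * (d1 / d2 + d2 / d1)) => s Is.
by rewrite addrA -hk// hE//; split; field; rewrite ?n0 ?d10 ?d20.
Qed.
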